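(* Let $R$ be a Noetherian ring and let $I\subset R$ be a proper ideal. Then $I$ satisfies the strong persistence property if and only if $I^{k+1}:I=I^k$ for all $k\ge 1$.
   Context: Rings are commutative with unit. $V(I)$ denotes the set of prime ideals of $R$ containing $I$. For $P\in\operatorname{Spec}(R)$, $\mathfrak m_P$ denotes the maximal ideal of the local ring $R_P$, and $I_P=IR_P$. Let $P\in V(I)$. The ideal $I$ satisfies the strong persistence property with respect to $P$ if for all integers $k\ge 1$ and all $f\in (I_P^k:\mathfrak m_P)\setminus I_P^k$ there exists $g\in I_P$ such that $fg\notin I_P^{k+1}$. The ideal $I$ satisfies the strong persistence property if it satisfies the strong persistence property with respect to every $P\in V(I)$. *)

(* Defs.v *)
From HB Require Import structures.
From mathcomp Require Import all_boot all_algebra.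
From mathcomp Require Import generic_quotient ring_quotient.
From mathcomp Require Import boolp classical_sets.
From mathcomp Require Import ring.

Set Implicit Arguments.
Unset Strict Implicit.
Unset Printing Implicit Defensive.

Import GRing.Theory.
Local Open Scope ring_scope.
Local Open Scope quotient_scope.
Local Open Scope classical_set_scope.

(* Ideals are classical sets and need not be proper, unlike the ideals
   [idealr R] of ring_quotient. Primes are bundled as [prime_idealr R]. *)

Section Ideals.
Variable R : comNzRingType.
Implicit Types I J K : set R.

Definition ideal J : Prop :=
  [/\ J 0, forall x y, J x -> J y -> J (x + y) &
      forall a x, J x -> J (a * x)].

Definition ideal_gen (A : set R) : set R := smallest ideal A.

Definition ideal_mul I J : set R :=
  ideal_gen [set z | exists x y, [/\ I x, J y & z = x * y]].

Definition ideal_exp I (k : nat) : set R := iter k (ideal_mul I) [set: R].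

Definition colon J K : set R := [set x | forall y, K y -> J (x * y)].

Definition maximal_ideal M : Prop :=
  [/\ ideal M, M <> [set: R] &
      forall J, ideal J -> M `<=` J -> J = M \/ J = [set: R]].

Lemma ideal_gen_ideal A : ideal (ideal_gen A).
Proof.
split=> [J [[]] //|x y Jx Jy J JA|a x Jx J JA].
- by case: (JA) => -[_ JD _] _; apply: JD; [apply: Jx|apply: Jy].
- by case: (JA) => -[_ _ JM] _; apply: JM; apply: Jx.
Qed.

Lemma sub_ideal_gen A : A `<=` ideal_gen A.
Proof. by move=> x Ax J [_]; apply. Qed.

End Ideals.

Definition noetherian (R : comNzRingType) : Prop :=
  forall J : set R, ideal J -> exists s : seq R, J = ideal_gen [set` s].

Module Localization.
Section Localization.
Variables (R : comNzRingType) (P : prime_idealr R).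

Record fraction := Fraction {
  numden : R * R;
  den_notin : numden.2 \notin (P : {pred R}) }.

HB.instance Definition _ := [isSub for numden].
HB.instance Definition _ := [Choice of fraction by <:].

Local Notation num x := (numden x).1.
Local Notation den x := (numden x).2.

Lemma one_notin : 1 \notin (P : {pred R}).
Proof. by rewrite idealr1. Qed.

Lemma mul_notin (s t : R) : s \notin (P : {pred R}) ->
  t \notin (P : {pred R}) -> s * t \notin (P : {pred R}).
Proof. by move=> sP tP; rewrite prime_idealrM negb_or sP. Qed.

Definition equiv (x y : fraction) : bool :=
  `[< exists2 u, u \notin (P : {pred R}) &
        u * (num x * den y - num y * den x) = 0 >].

Lemma equiv_refl : reflexive equiv.
Proof. by move=> x; apply/asboolP; exists 1; [exact: one_notin|ring]. Qed.

Lemma equiv_sym : symmetric equiv.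
Proof.
suff sub x y : equiv x y -> equiv y x by move=> x y; apply/idP/idP; exact: sub.
move=> /asboolP[u uP e]; apply/asboolP; exists u => //.
by rewrite -opprB mulrN e oppr0.
Qed.

Lemma equiv_trans : transitive equiv.
Proof.
move=> y x z /asboolP[u uP e] /asboolP[v vP f]; apply/asboolP.
exists (u * v * den y); first by rewrite !mul_notin ?den_notin.
rewrite (_ : _ * _ = v * den z * (u * (num x * den y - num y * den x)) +
   u * den x * (v * (num y * den z - num z * den y))); last by ring.
by rewrite e f; ring.
Qed.

Canonical equiv_equiv := EquivRel equiv equiv_refl equiv_sym equiv_trans.

Definition type := {eq_quot equiv}.

HB.instance Definition _ : EqQuotient _ equiv type := EqQuotient.on type.
HB.instance Definition _ := Choice.on type.

Definition addf x y : fraction :=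
  @Fraction (num x * den y + num y * den x, den x * den y)
    (mul_notin (den_notin x) (den_notin y)).
Definition mulf x y : fraction :=
  @Fraction (num x * num y, den x * den y)
    (mul_notin (den_notin x) (den_notin y)).
Definition oppf x : fraction := @Fraction (- num x, den x) (den_notin x).
Definition embf a : fraction := @Fraction (a, 1) one_notin.

Definition add := lift_op2 type addf.
Definition mul := lift_op2 type mulf.
Definition opp := lift_op1 type oppf.
Definition emb := lift_embed type embf.
Canonical pi_emb_morph := PiEmbed emb.

Lemma repr_equiv x : exists2 u, u \notin (P : {pred R}) &
  u * (num (repr (\pi_type x)) * den x - num x * den (repr (\pi_type x))) = 0.
Proof.
have /eqmodP/asboolP[u uP e] : repr (\pi_type x) = x %[mod type] by rewrite reprK.
by exists u.
Qed.

Lemma pi_add : {morph \pi : x y / addf x y >-> add x y}.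
Proof.
move=> x y; unlock add; apply/eqmodP/asboolP.
have [u uP] := repr_equiv x; have [v vP] := repr_equiv y.
move: (repr _) (repr _) => x' y' f e.
exists (u * v); first exact: mul_notin.
rewrite /= (_ : _ * _ = - (den y * den y' * v *
     (u * (num x' * den x - num x * den x'))) - den x * den x' * u *
     (v * (num y' * den y - num y * den y'))); last by ring.
by rewrite e f; ring.
Qed.
Canonical pi_add_morph := PiMorph2 pi_add.

Lemma pi_mul : {morph \pi : x y / mulf x y >-> mul x y}.
Proof.
move=> x y; unlock mul; apply/eqmodP/asboolP.
have [u uP] := repr_equiv x; have [v vP] := repr_equiv y.
move: (repr _) (repr _) => x' y' f e.
exists (u * v); first exact: mul_notin.
rewrite /= (_ : _ * _ = - (num y * den y' * v *
     (u * (num x' * den x - num x * den x'))) - num x' * den x * u *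
     (v * (num y' * den y - num y * den y'))); last by ring.
by rewrite e f; ring.
Qed.
Canonical pi_mul_morph := PiMorph2 pi_mul.

Lemma pi_opp : {morph \pi : x / oppf x >-> opp x}.
Proof.
move=> x; unlock opp; apply/eqmodP/asboolP.
have [u uP] := repr_equiv x; move: (repr _) => x' e.
exists u => //=.
by rewrite (_ : _ * _ = u * (num x' * den x - num x * den x')) //; ring.
Qed.
Canonical pi_opp_morph := PiMorph1 pi_opp.

Lemma fraction_inj (x y : fraction) : num x = num y -> den x = den y -> x = y.
Proof.
by case: x y => [[a s] sP] [[b t] tP] /= ab st; apply: val_inj; rewrite /= ab st.
Qed.

Lemma addA : associative add.
Proof.
elim/quotW=> x; elim/quotW=> y; elim/quotW=> z; rewrite !piE.
by congr \pi; apply: fraction_inj => /=; ring.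
Qed.

Lemma addC : commutative add.
Proof.
elim/quotW=> x; elim/quotW=> y; rewrite !piE.
by congr \pi; apply: fraction_inj => /=; ring.
Qed.

Lemma add0 : left_id (emb 0) add.
Proof.
elim/quotW=> x; rewrite !piE.
by congr \pi; apply: fraction_inj => /=; ring.
Qed.

Lemma addN : left_inverse (emb 0) opp add.
Proof.
elim/quotW=> x; rewrite !piE; apply/eqP; rewrite eqmodE.
by apply/asboolP; exists 1; [exact: one_notin|rewrite /=; ring].
Qed.

HB.instance Definition _ := GRing.isZmodule.Build type addA addC add0 addN.

Lemma mulA : associative mul.
Proof.
elim/quotW=> x; elim/quotW=> y; elim/quotW=> z; rewrite !piE.
by congr \pi; apply: fraction_inj => /=; ring.
Qed.

Lemma mulC : commutative mul.
Proof.
elim/quotW=> x; elim/quotW=> y; rewrite !piE.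
by congr \pi; apply: fraction_inj => /=; ring.
Qed.

Lemma mul1 : left_id (emb 1) mul.
Proof.
elim/quotW=> x; rewrite !piE.
by congr \pi; apply: fraction_inj => /=; ring.
Qed.

Lemma mulDl : left_distributive mul add.
Proof.
elim/quotW=> x; elim/quotW=> y; elim/quotW=> z; rewrite !piE.
apply/eqP; rewrite eqmodE.
by apply/asboolP; exists 1; [exact: one_notin|rewrite /=; ring].
Qed.

Lemma nonzero1 : emb 1 != emb 0 :> type.
Proof.
rewrite !piE; apply/asboolP => -[u uP] /=.
rewrite mulr1 mul0r subr0 mulr1 => u0.
by rewrite u0 idealr0 in uP.
Qed.

HB.instance Definition _ :=
  GRing.Zmodule_isComNzRing.Build type mulA mulC mul1 mulDl nonzero1.

Lemma emb_zmod : zmod_morphism (emb : R -> type).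
Proof.
move=> a b; apply/eqP; rewrite -[X in _ == X]/(add (emb a) (opp (emb b))).
rewrite !piE.
by apply/asboolP; exists 1; [exact: one_notin|rewrite /=; ring].
Qed.

Lemma emb_monoid : monoid_morphism (emb : R -> type).
Proof.
split=> [//|a b]; apply/eqP; rewrite -[X in _ == X]/(mul (emb a) (emb b)) !piE.
by apply/asboolP; exists 1; [exact: one_notin|rewrite /=; ring].
Qed.

HB.instance Definition _ := GRing.isZmodMorphism.Build R type emb emb_zmod.
HB.instance Definition _ := GRing.isMonoidMorphism.Build R type emb emb_monoid.

End Localization.
End Localization.
HB.export Localization.

Notation localization := Localization.type.

Section LocalRing.
Variables (R : comNzRingType) (P : prime_idealr R).

Definition to_loc : {rmorphism R -> localization P} := @Localization.emb R P.

Definition ideal_loc (J : set R) : set (localization P) :=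
  ideal_gen (to_loc @` J).

(* [maximal_idealP] below: P R_P is the unique maximal ideal of R_P. *)
Definition loc_max : set (localization P) := ideal_loc [set` P].

Lemma to_loc_eq0 (a : R) :
  to_loc a = 0 <-> exists2 u, u \notin (P : {pred R}) & u * a = 0.
Proof.
rewrite -(rmorph0 to_loc); split.
  move=> /eqP; rewrite !piE => /asboolP[u uP] /=.
  by rewrite mulr1 mul0r subr0; exists u.
move=> [u uP ua]; apply/eqP; rewrite !piE; apply/asboolP.
by exists u => //=; rewrite mulr1 mul0r subr0.
Qed.

Lemma to_loc_unit (s : R) : s \notin (P : {pred R}) ->
  exists z : localization P, to_loc s * z = 1.
Proof.
move=> sP; exists (\pi_(localization P) (@Localization.Fraction R P (1, s) sP)).
apply/eqP; rewrite -[X in X == _]/(Localization.mul _ _).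
rewrite -[X in _ == X]/(Localization.emb P 1) !piE; apply/asboolP.
by exists 1; [exact: Localization.one_notin|rewrite /=; ring].
Qed.

Lemma loc_fraction (z : localization P) : exists a s,
  s \notin (P : {pred R}) /\ to_loc s * z = to_loc a.
Proof.
elim/quotW: z => -[[a s] sP]; exists a, s; split=> //.
apply/eqP; rewrite -[X in X == _]/(Localization.mul _ _) !piE.
by apply/asboolP; exists 1; [exact: Localization.one_notin|rewrite /=; ring].
Qed.

Lemma loc_max_num (z : localization P) a s : s \notin (P : {pred R}) ->
  to_loc s * z = to_loc a -> loc_max z <-> a \in (P : {pred R}).
Proof.
pose K : set (localization P) := [set z | forall a s,
  s \notin (P : {pred R}) -> to_loc s * z = to_loc a -> a \in (P : {pred R})].
have PE x y : to_loc x = to_loc y -> x \in (P : {pred R}) -> y \in (P : {pred R}).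
  move=> /eqP; rewrite -subr_eq0 -rmorphB => /eqP/to_loc_eq0[u uP] e xP.
  have : u * (x - y) \in (P : {pred R}) by rewrite e idealr0.
  by rewrite prime_idealrM (negPf uP) /= => /(rpredB xP); rewrite subKr.
have Knum z' b t : t \notin (P : {pred R}) -> to_loc t * z' = to_loc b ->
    b \in (P : {pred R}) -> K z'.
  move=> tP e bP c u uP f.
  have : u * b \in (P : {pred R}) by rewrite idealMr.
  have -> // : (u * b \in (P : {pred R})) = (t * c \in (P : {pred R})).
    have ee : to_loc (u * b) = to_loc (t * c).
      by rewrite !rmorphM /= -e -f mulrCA.
    by apply/idP/idP; apply: PE.
  by rewrite prime_idealrM (negPf tP).
have idK : ideal K.
  split.
  - by apply: (Knum _ 0 1); rewrite ?Localization.one_notin ?idealr0 // mulr0 rmorph0.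
  - move=> x y Kx Ky.
    have [b [t [tP e]]] := loc_fraction x; have [c [u [uP f]]] := loc_fraction y.
    apply: (Knum _ (u * b + t * c) (t * u)); first exact: Localization.mul_notin.
      by rewrite rmorphD !rmorphM /= -e -f; ring.
    by rewrite rpredD // idealMr //; [apply: Kx e|apply: Ky f].
  - move=> x y Ky.
    have [b [t [tP e]]] := loc_fraction x; have [c [u [uP f]]] := loc_fraction y.
    apply: (Knum _ (b * c) (t * u)); first exact: Localization.mul_notin.
      by rewrite !rmorphM /= -e -f; ring.
    by rewrite idealMr //; apply: Ky f.
move=> sP e; split.
  move=> mz; have Kz : K z.
    apply: mz; split=> // _ [b bP <-].
    apply: (Knum _ b 1) => //; first exact: Localization.one_notin.
    by rewrite rmorph1 mul1r.
  exact: Kz e.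
move=> aP; have [t st] := to_loc_unit sP.
have -> : z = t * to_loc a by rewrite -e mulrA [t * _]mulrC st mul1r.
have [_ _ mM] := ideal_gen_ideal (to_loc @` [set` P]).
by apply: mM; apply: sub_ideal_gen; exists a.
Qed.

Lemma maximal_idealP (M : set (localization P)) :
  maximal_ideal M <-> M = loc_max.
Proof.
have idm : ideal loc_max by exact: ideal_gen_ideal.
have m1 : ~ loc_max 1.
  have e : to_loc 1 * 1 = to_loc 1 by rewrite mulr1.
  move/(loc_max_num (Localization.one_notin P) e).
  by rewrite (negPf (Localization.one_notin P)).
have out J : ideal J -> ~ J `<=` loc_max -> J = [set: localization P].
  move=> [_ _ JM] nJ; apply: contrapT => nT; apply: nJ => z Jz.
  have [a [s [sP e]]] := loc_fraction z.
  apply/(loc_max_num sP e); apply: contrapT => /negP aP; apply: nT.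
  have [b ab] := to_loc_unit aP.
  apply/seteqP; split=> // x _.
  have -> : x = (x * b * to_loc s) * z by rewrite -mulrA e -mulrA [b * _]mulrC ab mulr1.
  exact: JM.
split=> [[idM nM maxM]|->].
  have Mm : M `<=` loc_max by apply: contrapT => /(out _ idM).
  by case: (maxM _ idm Mm) => [//|mT]; case: m1; rewrite mT.
split=> // [mT|J idJ mJ]; first by apply: m1; rewrite mT.
have [Jm|nJ] := pselect (J `<=` loc_max); last by right; apply: out.
by left; apply/seteqP.
Qed.

End LocalRing.

Arguments to_loc {R} P.
Arguments ideal_loc {R} P J.
Arguments loc_max {R} P.

Definition strong_persistence_at (R : comNzRingType) (I : set R)
    (P : prime_idealr R) : Prop :=
  let IP := ideal_loc P I in
  forall k : nat, (1 <= k)%N ->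
  forall f : localization P,
    (colon (ideal_exp IP k) (loc_max P) `\` ideal_exp IP k) f ->
    exists2 g : localization P, IP g & ~ ideal_exp IP k.+1 (f * g).

Definition strong_persistence (R : comNzRingType) (I : set R) : Prop :=
  forall P : prime_idealr R, I `<=` [set` P] -> strong_persistence_at I P.

(* Main.v *)
(** For the forward implication, a maximal annihilator of the form [I^k : rx],
    with [x] in [(I^(k+1) : I) \ I^k], is a prime [P] containing [I], and the
    image of [rx] in [R_P] contradicts strong persistence at [P]. The converse
    holds because colons by the finitely generated ideal [I] commute with
    localization. *)

Require Import Defs.
From HB Require Import structures.
From mathcomp Require Import all_boot all_algebra.
From mathcomp Require Import ring_quotient boolp classical_sets.
From mathcomp Require Import ring.

Local Open Scope classical_set_scope.

Import GRing.Theory.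
Local Open Scope ring_scope.

(** * Ideals, colons and the Noetherian condition *)

Section Ideals.
Variable R : comNzRingType.
Implicit Types A I J K : set R.

Lemma ideal_gen_sub A J : ideal J -> A `<=` J -> ideal_gen A `<=` J.
Proof. by move=> idJ AJ; apply: smallest_sub. Qed.

Lemma ideal_setT : ideal [set: R].
Proof. by []. Qed.

Lemma ideal_mulr J a x : ideal J -> J a -> J (a * x).
Proof. by move=> [_ _ JM] Ja; rewrite mulrC; apply: JM. Qed.

Lemma ideal_colon J K : ideal J -> ideal (colon J K).
Proof.
move=> [J0 JD JM]; split=> [y _|x y Jx Jy z Kz|a x Jx z Kz].
- by rewrite mul0r.
- by rewrite mulrDl; apply: JD; [apply: Jx|apply: Jy].
- by rewrite -mulrA; apply: JM; apply: Jx.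
Qed.

Lemma mem_ideal_mul I J x y : I x -> J y -> ideal_mul I J (x * y).
Proof. by move=> Ix Jy; apply: sub_ideal_gen; exists x, y. Qed.

Lemma ideal_exp_ideal I k : ideal (ideal_exp I k).
Proof. by case: k => [|k]; [exact: ideal_setT|exact: ideal_gen_ideal]. Qed.

Lemma mem_ideal_exp I k x : I x -> ideal_exp I k (x ^+ k).
Proof.
by move=> Ix; elim: k => [//|k IHk]; rewrite exprS; apply: mem_ideal_mul.
Qed.

Lemma ideal_exp_colon I k : ideal_exp I k `<=` colon (ideal_exp I k.+1) I.
Proof. by move=> x Ikx y Iy; rewrite mulrC; apply: mem_ideal_mul. Qed.

(** The union of the chain is an ideal, hence finitely generated. Finitely many generators already
    lie in one member, which is then the whole union. *)
Lemma noetherian_chain (C : set (set R)) : noetherian R ->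
  C `<=` @ideal R -> C !=set0 -> total_on C subset -> C (\bigcup_(X in C) X).
Proof.
move=> hR Cid [A CA] totC.
have idC : ideal (\bigcup_(X in C) X).
  split.
  - by exists A => //; have [] := Cid _ CA.
  - move=> x y [B CB Bx] [D CD Dy]; have [BD|DB] := totC _ _ CB CD.
    + by exists D => //; have [_ DD _] := Cid _ CD; apply: DD => //; apply: BD.
    + by exists B => //; have [_ BD _] := Cid _ CB; apply: BD => //; apply: DB.
  - by move=> a x [B CB Bx]; exists B => //; have [_ _] := Cid _ CB; apply.
have [s Cs] := hR _ idC.
have : [set` s] `<=` \bigcup_(X in C) X by rewrite Cs; apply: sub_ideal_gen.
suff: forall t : seq R, [set` t] `<=` \bigcup_(X in C) X ->
    exists2 B, C B & [set` t] `<=` B.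
  move=> /[apply] -[B CB sB].
  suff -> : \bigcup_(X in C) X = B by [].
  apply/seteqP; split=> [|x Bx]; last by exists B.
  by rewrite Cs; apply: ideal_gen_sub => //; apply: Cid.
elim=> [_|x t IHt xtC]; first by exists A.
have [|B CB tB] := IHt; first by move=> y yt; apply: xtC; rewrite /= inE yt orbT.
have [|D CD Dx] := xtC x; first by rewrite /= mem_head.
have [BD|DB] := totC _ _ CB CD; [exists D|exists B] => // y;
  rewrite /= inE => /predU1P[->|/tB] //; [exact: BD|exact: DB].
Qed.

Lemma noetherian_max (F : set (set R)) : noetherian R ->
  F `<=` @ideal R -> F !=set0 ->
  exists2 A, F A & forall B, F B -> A `<=` B -> B `<=` A.
Proof.
move=> hR Fid [A0 FA0].
(* [Zorn_bigcup] also requires the union of the empty chain, which adjoining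
   [A0] keeps in the family. *)
have [C CF totC|A [FA maxA]] := @Zorn_bigcup R [set A | F (A `|` A0)].
- have [C0|/set0P[X CX]] := eqVneq C set0; first by rewrite /= C0 bigcup_set0 set0U.
  have /= := noetherian_chain [set X `|` A0 | X in C] hR.
  rewrite bigcup_image -bigcupUl; last by exists X.
  have imF : [set X `|` A0 | X in C] `<=` F by move=> _ [Y /CF FY <-].
  move=> chain; apply/imF/chain; first exact: subset_trans Fid.
    by exists (X `|` A0), X.
  move=> _ _ [Y CY <-] [Z CZ <-].
  by case: (totC _ _ CY CZ) => YZ; [left|right]; apply: setSU.
- exists (A `|` A0) => // B FB AB; apply: contrapT => nBA.
  have BE : B `|` A0 = B.
    by apply/setUidPl; apply: subset_trans AB.
  case: (maxA B); last by rewrite /= BE.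
  split; first by apply: subset_trans AB.
  by move=> BA; apply: nBA => x /BA; left.
Qed.

(** Among the ideals [J : y] with [y] a multiple of [x] outside [J], a maximal one is prime. If
    [a * b] carries [y] into [J] and [b] does not, then [J : (b * y)] belongs to the family and
    contains [J : y], so by maximality [a], which lies in the former, lies in the latter. *)
Lemma associated_prime J x : noetherian R -> ideal J -> ~ J x ->
  exists r (P : prime_idealr R), ~ J (r * x) /\
    forall a, a \in (P : {pred R}) <-> J (a * (r * x)).
Proof.
move=> hR idJ nJx; have [J0 JD JM] := idJ.
pose ann y := [set a | J (a * y)].
have annid y : ideal (ann y).
  split=> [|a b Ja Jb|a b Jb]; rewrite /ann /=.
  - by rewrite mul0r.
  - by rewrite mulrDl; apply: JD.
  - by rewrite -mulrA; apply: JM.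
have [_ [y [r [-> nJrx] <-]] maxy] :
    exists2 A, (ann @` [set y | exists r, y = r * x /\ ~ J y]) A &
    forall B, (ann @` [set y | exists r, y = r * x /\ ~ J y]) B ->
      A `<=` B -> B `<=` A.
  apply: noetherian_max => // [_ [y _ <-]|]; first exact: annid.
  by exists (ann x), x => //; exists 1; rewrite mul1r.
pose p : R -> bool := fun a => `[< J (a * (r * x)) >].
have p_ideal : idealr_closed p.
  split.
  - by apply/asboolP; rewrite mul0r.
  - by apply/asboolP; rewrite mul1r.
  - move=> a b c /asboolP Jb /asboolP Jc; apply/asboolP.
    by rewrite mulrDl -mulrA; apply: JD => //; apply: JM.
have p_prime : prime_idealr_closed p.
  move=> a b /asboolP Jab; apply/orP.
  have [pb|npb] := boolP (b \in p); [by right|left].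
  apply/asboolP/(maxy (ann (b * (r * x)))).
  + exists (b * (r * x)) => //; exists (b * r); rewrite mulrA; split=> //.
    by rewrite -mulrA => /asboolP; apply/negP.
  + by move=> c Jc; rewrite /ann /= mulrCA; apply: JM.
  + by rewrite /ann /= mulrA.
pose zP := GRing.isZmodClosed.Build R p (idealr_closedB p_ideal).
pose iP := isProperIdeal.Build R p (idealr_closed_nontrivial p_ideal).
pose pP := isPrimeIdealrClosed.Build R p p_prime.
pose P : prime_idealr R := HB.pack p zP iP pP.
by exists r, P; split=> // a; split=> /asboolP.
Qed.

(** Makes the multiplier [u] uniform in [g]: the product of the multipliers of finitely many
    generators of [I] serves for all of them, hence for [I]. It is applied with [C] the complement
    of a prime. *)
Lemma ideal_annihilated I J a (C : set R) : noetherian R ->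
  ideal I -> ideal J -> C 1 -> (forall u v, C u -> C v -> C (u * v)) ->
  (forall g, I g -> exists2 u, C u & J (u * a * g)) ->
  exists2 u, C u & colon J I (u * a).
Proof.
move=> hR idI idJ C1 CM; have [s ->] := hR _ idI => Cs.
have [_ _ JM] := idJ.
have [u Cu us] : exists2 u, C u & [set` s] `<=` [set g | J (u * a * g)].
  have: [set` s] `<=` ideal_gen [set` s] by exact: sub_ideal_gen.
  (* The induction runs over lists [t] inside the fixed ideal generated by [s], so that [Cs] stays
     available for each element of [t]. *)
  elim: {-2}s => [_|g t IHt gtI]; first by exists 1.
  have [|u Cu ut] := IHt; first by move=> y yt; apply: gtI; rewrite /= inE yt orbT.
  have [|v Cv vg] := Cs g; first by apply: gtI; rewrite /= mem_head.
  exists (u * v); first exact: CM.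
  move=> y; rewrite /= inE => /predU1P[->|/ut Jy].
    by rewrite -!mulrA; apply: JM; rewrite mulrA.
  by rewrite [u * v]mulrC -!mulrA; apply: JM; rewrite mulrA.
exists u => // g; apply: ideal_gen_sub us g; rewrite -/(colon J).
have [J0 JD _] := idJ; split=> [|x y|b x] /=; first by rewrite mulr0.
- by move=> *; rewrite mulrDr; apply: JD.
- by move=> ?; rewrite mulrCA; apply: JM.
Qed.

End Ideals.

(** * Extension of ideals to the localization at a prime *)

Section LocalIdeals.
Variables (R : comNzRingType) (P : prime_idealr R).
Implicit Types I J : set R.

Lemma mem_ideal_loc J x : J x -> ideal_loc P J (to_loc P x).
Proof. by move=> Jx; apply: sub_ideal_gen; exists x. Qed.

(** Common denominators show that the fractions having some numerator in [J] already form an ideal.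
    As [J] need not be prime, other numerators of the same fraction may lie outside [J]. *)
Lemma ideal_locP J (z : localization P) : ideal J ->
  ideal_loc P J z <->
  exists a s, [/\ J a, s \notin (P : {pred R}) & to_loc P s * z = to_loc P a].
Proof.
move=> [J0 JD JM]; split=> [|[a [s [Ja sP e]]]]; last first.
  have [t st] := to_loc_unit sP.
  rewrite (_ : z = t * to_loc P a); last by rewrite -e mulrA [t * _]mulrC st mul1r.
  by have [_ _] := ideal_gen_ideal (to_loc P @` J); apply; apply: mem_ideal_loc.
pose K := [set z | exists a s,
  [/\ J a, s \notin (P : {pred R}) & to_loc P s * z = to_loc P a]].
apply: (@ideal_gen_sub _ _ K) => [|_ [a Ja <-]]; last first.
  by exists a, 1; rewrite rmorph1 mul1r; split=> //; exact: Localization.one_notin.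
split.
- by exists 0, 1; rewrite rmorph0 mulr0; split=> //; exact: Localization.one_notin.
- move=> x y [a [s [Ja sP e]]] [b [t [Jb tP f]]].
  exists (t * a + s * b), (s * t); split; first by apply: JD; apply: JM.
    exact: Localization.mul_notin.
  by rewrite rmorphD !rmorphM /= -e -f; ring.
- move=> x y [b [t [Jb tP f]]]; have [a [s [sP e]]] := loc_fraction x.
  exists (a * b), (s * t); split; first exact: JM.
    exact: Localization.mul_notin.
  by rewrite !rmorphM /= -e -f; ring.
Qed.

(** If [a] equals [b / s] in the localization with [b] in [J], some [u] outside [P] gives
    [u * s * a = u * b], so [u * s] is the required multiplier. *)
Lemma to_loc_idealP J a : ideal J ->
  ideal_loc P J (to_loc P a) <-> exists2 u, u \notin (P : {pred R}) & J (u * a).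
Proof.
move=> idJ; rewrite ideal_locP //; split=> [[b [s [Jb sP]]]|[u uP Jua]]; last first.
  by exists (u * a), u; rewrite rmorphM.
rewrite -rmorphM => /eqP; rewrite -subr_eq0 -rmorphB => /eqP/to_loc_eq0[u uP].
rewrite mulrBr => /eqP; rewrite subr_eq0 mulrA => /eqP e.
exists (u * s); first exact: Localization.mul_notin.
by rewrite e; have [_ _] := idJ; apply.
Qed.

Lemma ideal_loc_mul I J : ideal I -> ideal J ->
  ideal_loc P (ideal_mul I J) = ideal_mul (ideal_loc P I) (ideal_loc P J).
Proof.
move=> idI idJ; have [L0 LD LM] : ideal (ideal_mul (ideal_loc P I) (ideal_loc P J)).
  exact: ideal_gen_ideal.
apply/seteqP; split.
  apply: ideal_gen_sub; first exact: ideal_gen_ideal.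
  move=> _ [x IJx <-]; move: x IJx.
  apply: ideal_gen_sub => [|_ [x [y [Ix Jy ->]]]].
    split=> [|x y|a x] /=; first by rewrite rmorph0.
    - by rewrite rmorphD; apply: LD.
    - by rewrite rmorphM; apply: LM.
  by rewrite /= rmorphM; apply: mem_ideal_mul; apply: mem_ideal_loc.
apply: ideal_gen_sub; first exact: ideal_gen_ideal.
move=> _ [x [y [Ix Jy ->]]].
have /(ideal_locP _ _ idI)[a [s [Ia sP e]]] := Ix.
have /(ideal_locP _ _ idJ)[b [t [Jb tP f]]] := Jy.
apply/ideal_locP; first exact: ideal_gen_ideal.
exists (a * b), (s * t); split; first exact: mem_ideal_mul.
  exact: Localization.mul_notin.
by rewrite !rmorphM /= -e -f; ring.
Qed.

Lemma ideal_loc_exp I k : ideal I ->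
  ideal_loc P (ideal_exp I k) = ideal_exp (ideal_loc P I) k.
Proof.
move=> idI; elim: k => [|k IHk]; last first.
  by rewrite [in LHS]/ideal_exp iterS ideal_loc_mul ?IHk //; exact: ideal_exp_ideal.
apply/seteqP; split=> // z _; rewrite -[z]mulr1 -(rmorph1 (to_loc P)).
by have [_ _] := ideal_gen_ideal (to_loc P @` [set: R]); apply; apply: mem_ideal_loc.
Qed.

(** For [z = a / s], each [g] in [I] has a [u] outside [P] with [u * a * g] in [J]. A uniform [u]
    puts [u * a] in [colon J I], and [z = (u * a) / (u * s)]. *)
Lemma colon_loc_sub I J : noetherian R -> ideal I -> ideal J ->
  colon (ideal_loc P J) (ideal_loc P I) `<=` ideal_loc P (colon J I).
Proof.
move=> hR idI idJ z zIJ; have [a [s [sP e]]] := loc_fraction z.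
have [_ _ LM] := ideal_gen_ideal (to_loc P @` J).
have [|u v uP vP|g Ig|u uP uaJ] := ideal_annihilated _ I J a
    [set u | u \notin (P : {pred R})] hR idI idJ.
- exact: Localization.one_notin.
- exact: Localization.mul_notin.
- have /(to_loc_idealP _ _ idJ)[u uP] : ideal_loc P J (to_loc P (a * g)).
    rewrite rmorphM /= -e -mulrA; apply: LM.
    by apply: zIJ; apply: mem_ideal_loc.
  by rewrite mulrA; exists u.
- apply/ideal_locP; first exact: ideal_colon.
  exists (u * a), (u * s); split=> //; first exact: Localization.mul_notin.
  by rewrite !rmorphM -e mulrA.
Qed.

End LocalIdeals.

Theorem theorem1p3 (R : comNzRingType) (I : set R)
    (hR : noetherian R) (hI : ideal I) (hI_proper : I <> [set: R]) :
  strong_persistence I <->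
  forall k : nat, (1 <= k)%N ->
    colon (ideal_exp I k.+1) I = ideal_exp I k.
Proof.
split=> [spI k k_gt0|colonI P IP LI k k_gt0 f [_ nf]].
  apply/seteqP; split=> [x xI|]; last exact: ideal_exp_colon.
  apply: contrapT => nx.
  have idIk := ideal_exp_ideal _ I k; have idIk1 := ideal_exp_ideal _ I k.+1.
  have [r [P [nrx Pann]]] := associated_prime _ _ _ hR idIk nx.
  (* For [a] in [I], the power [a ^+ k] carries [r * x] into $I^k$, so it lies in [P], and primality
     brings [a] itself into [P]. *)
  have IP : I `<=` [set` P].
    move=> a Ia; have : a ^+ k \in (P : {pred R}).
      by apply/Pann; apply: ideal_mulr => //; apply: mem_ideal_exp.
    elim: (k) => [|n IHn]; first by rewrite expr0 idealr1.
    by rewrite exprS prime_idealrM => /orP[].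
  (* The image of [r * x] is outside $I_P^k$, since a multiplier of [r * x] into $I^k$ lies in [P].
     It is in $I_P^k:\mathfrak m_P$, since numerators of elements of $\mathfrak m_P$ lie in [P]. *)
  have [] := spI P IP k k_gt0 (to_loc P (r * x)).
    rewrite -ideal_loc_exp //; split; last first.
      by move=> /(to_loc_idealP _ _ _ _ idIk)[u /negP uP /Pann].
    move=> z mz; have [a [s [sP e]]] := loc_fraction z.
    have /(loc_max_num sP e)/Pann Ja := mz.
    apply/ideal_locP => //; exists (a * (r * x)), s; split=> //.
    by rewrite mulrCA e -rmorphM mulrC.
  (* No [g = a / s] in $I_P$ can be a witness: [x * a] is in $I^{k+1}$ by the choice of [x], so the
     product with [g] stays in $I_P^{k+1}$. *)
  move=> g /(ideal_locP _ _ _ _ hI)[a [s [Ia sP e]]]; apply.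
  rewrite -ideal_loc_exp //; apply/ideal_locP => //.
  exists (r * x * a), s; split=> //; last by rewrite mulrCA e -rmorphM.
  by rewrite -mulrA; have [_ _] := idIk1; apply; apply: xI.
(* Without a witness [g], [f] lies in $I_P^{k+1}:I_P$, hence in the localization of
   $I^{k+1}:I=I^k$. *)
apply: contrapT => nog; apply: nf.
rewrite -ideal_loc_exp // -colonI //.
apply: colon_loc_sub => //; first exact: ideal_exp_ideal.
move=> g Ig; rewrite ideal_loc_exp //; apply: contrapT => nfg.
by apply: nog; exists g.
Qed.
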